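(* Consider the bilinear differential equation $$2f_{xt}f-2f_{t}f_{x}+6(f_{xx})^2=0 .$$ The only fundamental solutions $f\in\mathbb{C}[x,t]$ of this equation are $$f(x,t)=1,$$ $$f(x,t)=x+c_{0},$$ $$f(x,t)=x^3+c_{2}x^2+\tfrac{1}{3}c_{2}^2x+36t+c_{0},$$ and $$f(x,t)=x^4+c_{3}x^3+c_{2}x^2+(144t+c_{1})x+36c_{3}t+\tfrac{1}{4}c_{1}c_{3}-\tfrac{1}{12}c_{2}^2,$$ for arbitrary constants $c_{0},c_{1},c_{2},c_{3}\in\mathbb{C}$. That is, a polynomial $f\in\mathbb{C}[x,t]$ which is monic in $x$ satisfies the equation if and only if it is of one of these four forms for some choice of the constants.
   Context: Subscripts denote partial derivatives. A polynomial $f\in\mathbb{C}[x,t]$ is monic in $x$ if, written as $f=\sum_{j=0}^{m}f_j(t)x^j$ with $m=\deg_x f$, it has $f_m(t)=1$. A fundamental solution of the bilinear equation is a polynomial solution $f\in\mathbb{C}[x,t]$ that is monic in $x$. *)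

(* Defs.v *)
From HB Require Import structures.
From mathcomp Require Import all_boot all_order all_algebra.

Set Implicit Arguments.
Unset Strict Implicit.
Unset Printing Implicit Defensive.

Import Order.TTheory GRing.Theory Num.Theory.
Local Open Scope ring_scope.

Section Bilinear.
Variable C : comNzRingType.

(* C[x, t] is encoded as C[t][x]: the outer variable is x, the inner one is t,
   so the library predicate [f \is monic] means monic in x. *)
Definition bipoly := {poly {poly C}}.

Definition Xx : bipoly := 'X.
Definition Xt : bipoly := 'X%:P.
Definition cst (c : C) : bipoly := c%:P%:P.

Definition dx (f : bipoly) : bipoly := f^`().
Definition dt (f : bipoly) : bipoly := map_poly (@deriv C) f.

Definition bilinear_eq (f : bipoly) : Prop :=
  2 * dt (dx f) * f - 2 * dt f * dx f + 6 * dx (dx f) ^+ 2 = 0.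

Definition fundamental_solution (f : bipoly) : Prop :=
  f \is monic /\ bilinear_eq f.

End Bilinear.

Arguments Xx {C}.
Arguments Xt {C}.

(* Main.v *)
Require Import Defs.
From HB Require Import structures.
From mathcomp Require Import all_boot all_order all_algebra.
From mathcomp Require Import reals.
From mathcomp.real_closed Require Import complex.
From mathcomp Require Import ring zify.

Set Implicit Arguments.
Unset Strict Implicit.
Unset Printing Implicit Defensive.

Import Order.TTheory GRing.Theory Num.Theory.
Local Open Scope ring_scope.

(** Give x the weight 1 and t the weight 3.  Each of the three terms of the
    equation lowers the weight by 4 (relative to f * f), and this homogeneity
    controls the solutions.  Let n be the degree in x of a monic solution f.

    - All monomials of f have weight at most n ([weight_le_sol]): comparing the
      coefficients of x^(n+i-1) expresses the t-derivative of the coefficient of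
      x^i through the coefficients of higher powers of x, so the bound
      propagates downwards from the leading coefficient 1.

    - Hence the part F of weight n of f is itself a solution, and it contains
      x^n.  By Euler's relation x F_x + 3 t F_t = n F, the polynomial
      p(x) = F(x, 1) satisfies the ordinary differential equation
      x (p'^2 - p p'') - p p' + 9 p''^2 = 0, in which n no longer occurs
      ([selfsimilar_top]).  Only exponents congruent to n modulo 3 occur in p.

    - Near x = 0 the term 9 p''^2 dominates as soon as p vanishes to order at
      least 2, so p starts with a constant or with x ([order_lt2]).  After these
      one further term is possible, c + d x^3 or c x + d x^4, with d = 0 or
      d = c / 36, resp. d = c / 144; the next exponent k would have to be a root
      of an indicial polynomial that has no such root ([size_selfsimilar0],
      [size_selfsimilar1]).  Therefore n is 0, 1, 3 or 4 ([degree_cases]).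

    - For these n the weight bound makes every coefficient of f constant or
      affine in t, and substituting leaves finitely many equations for the
      constants ([cubic_sol], [quartic_sol]). *)

(** * Coefficients of univariate polynomials *)

Lemma coef_comp_scaleX (R : comNzRingType) (p : {poly R}) c i :
  (p \Po (c%:P * 'X))`_i = p`_i * c ^+ i.
Proof.
rewrite comp_polyE coef_sum.
under eq_bigr => j _ do
  rewrite exprMn -polyC_exp mul_polyC !coefZ coefXn mulrA.
have [ip|pi] := ltnP i (size p).
  rewrite (bigD1 (Ordinal ip)) //= eqxx mulr1 big1 ?addr0 // => j.
  by rewrite -val_eqE eq_sym => /negbTE /= ->; rewrite mulr0.
rewrite [p`_i]nth_default // mul0r big1 // => -[j /= jp] _.
by rewrite gtn_eqF ?mulr0 //; apply: leq_trans pi.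
Qed.

Lemma coefM_top (R : nzRingType) (p q : {poly R}) a b :
  (size p <= a.+1)%N -> (size q <= b.+1)%N -> (p * q)`_(a + b) = p`_a * q`_b.
Proof.
move=> pa qb; have ab : (a < (a + b).+1)%N by rewrite ltnS leq_addr.
rewrite coefM (bigD1 (Ordinal ab)) //= addKn big1 ?addr0 // => -[i /= ip].
rewrite -val_eqE /= neq_ltn => /orP[ia|ai].
  by rewrite [q`_ _]nth_default ?mulr0 //; apply: leq_trans qb _; lia.
by rewrite [p`_ _]nth_default ?mul0r //; apply: leq_trans pa _; lia.
Qed.

Lemma monicXnD (R : nzRingType) n (p : {poly R}) :
  (size p <= n)%N -> 'X^n + p \is monic.
Proof. by move=> pn; rewrite monicE lead_coefDl ?lead_coefXn // size_polyXn. Qed.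

(** * The bilinear operator on cubics and quartics *)

Definition derivation (A : pzRingType) (D : A -> A) :=
  {morph D : a b / a + b} /\ forall a b, D (a * b) = D a * b + a * D b.

(** Only the Leibniz rule and the values of the two derivations on x, t and the
    constants enter the expansions below, hence the abstract setting. *)
Section Derivation.
Variables (A : comPzRingType) (D : A -> A).
Hypothesis derD : derivation D.

Let derivD a b : D (a + b) = D a + D b. Proof. by case: derD => ->. Qed.
Let derivM a b : D (a * b) = D a * b + a * D b. Proof. by case: derD => _ ->. Qed.

Let deriv0 : D 0 = 0.
Proof. by apply: (addrI (D 0)); rewrite -derivD !addr0. Qed.

Let deriv1 : D 1 = 0.
Proof.
apply: (addrI (D 1)); rewrite -{1}(mulr1 (D 1)) -{2}(mul1r (D 1)).
by rewrite -derivM mulr1 addr0.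
Qed.

Let deriv_nat n : D n%:R = 0.
Proof.
by elim: n => [|n IHn]; rewrite ?deriv0 // -natr1 derivD IHn deriv1 addr0.
Qed.

Let derivX a n : D (a ^+ n.+1) = n.+1%:R * a ^+ n * D a.
Proof.
elim: n => [|n IHn]; first by rewrite expr1 expr0 !mul1r.
by rewrite exprS derivM IHn -[in RHS]natr1 exprS; ring.
Qed.

Definition derivationE := (derivD, derivX, derivM, deriv0, deriv1, deriv_nat).

End Derivation.

(** Half of the left-hand side of the equation, for d/dx = D and d/dt = T. *)
Definition hirota (A : pzRingType) (D T : A -> A) (f : A) :=
  T (D f) * f - T f * D f + 3 * D (D f) ^+ 2.

Definition xt_derivations (C A : comPzRingType) (k : C -> A) (X t : A)
    (D T : A -> A) :=
  [/\ derivation D /\ derivation T,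
      D X = 1 /\ D t = 0, T X = 0 /\ T t = 1
    & forall c, D (k c) = 0 /\ T (k c) = 0].

(** By the weight bound a monic solution of degree 3 has this shape.  No power of
    t survives in the result, so vanishing is a condition on the constants. *)
Lemma hirota_cubic (C A : comPzRingType) (k : {rmorphism C -> A}) X t D T
    c0 c1 c2 u :
  xt_derivations k X t D T ->
  let e := [:: 12 * c2 ^+ 2 - u * c1; 72 * c2 - 2 * u * c2; 108 - 3 * u] in
  hirota D T (X ^+ 3 + k c2 * X ^+ 2 + k c1 * X + k u * t + k c0)
  = \sum_(i < size e) k e`_i * X ^+ i.
Proof.
move=> [[derD derT] [DX Dt] [TX Tt] Dk].
have {Dk} [Dk Tk] : (forall c, D (k c) = 0) /\ (forall c, T (k c) = 0).
  by split=> c; case: (Dk c).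
have DE := (derivationE derD, DX, Dt, Dk).
have TE := (derivationE derT, TX, Tt, Tk).
rewrite /hirota !DE !TE !big_ord_recl big_ord0 /=; ring.
Qed.

(** The same in degree 4, where f = g + t h with h = u x + v.  Again t drops out:
    f_xt f - f_t f_x = h' g - h g', and h has no second derivative in x. *)
Lemma hirota_quartic (C A : comPzRingType) (k : {rmorphism C -> A}) X t D T
    c0 c1 c2 c3 u v :
  xt_derivations k X t D T ->
  let e := [:: u * c0 - v * c1 + 12 * c2 ^+ 2; 72 * c2 * c3 - 2 * v * c2;
               108 * c3 ^+ 2 + 144 * c2 - u * c2 - 3 * v * c3;
               432 * c3 - 2 * u * c3 - 4 * v; 432 - 3 * u] in
  hirota D T (X ^+ 4 + k c3 * X ^+ 3 + k c2 * X ^+ 2 + (k u * t + k c1) * X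
              + k v * t + k c0)
  = \sum_(i < size e) k e`_i * X ^+ i.
Proof.
move=> [[derD derT] [DX Dt] [TX Tt] Dk].
have {Dk} [Dk Tk] : (forall c, D (k c) = 0) /\ (forall c, T (k c) = 0).
  by split=> c; case: (Dk c).
have DE := (derivationE derD, DX, Dt, Dk).
have TE := (derivationE derT, TX, Tt, Tk).
rewrite /hirota !DE !TE !big_ord_recl big_ord0 /=; ring.
Qed.

(** * The ordinary differential equation of the part of top weight *)

Section SelfSimilar.
Variable C : numFieldType.
Implicit Types p r : {poly C}.

(** The equation satisfied by F(x, 1) when F is a solution homogeneous for the
    weights 1 and 3 of x and t. *)
Definition selfsimilar p : Prop :=
  'X * (p^`() ^+ 2 - p * p^`()^`()) - p * p^`() + 9 * p^`()^`() ^+ 2 = 0.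

Lemma deriv_XnSM m r :
  ('X^(m.+1) * r)^`() = 'X^m * (m.+1%:R * r + 'X * r^`()).
Proof. by rewrite derivM derivXn exprS -mulr_natl /=; ring. Qed.

Definition coef0E := (@coefD, coefN, @coef0M, @coefX, @coefC, @coefZ).

(** Splitting off the exact order of vanishing at 0, also in the first two
    derivatives.  The order is written (m + k).+2 so that all exponents stay
    free of subtraction. *)
Lemma lowest_term p k :
  p != 0 -> (forall i, (i < k.+2)%N -> p`_i = 0) ->
  exists m r r1 r2,
    [/\ r`_0 != 0,
        p = 'X^((m + k).+2) * r,
        p^`() = 'X^((m + k).+1) * r1 /\ r1`_0 = (m + k).+2%:R * r`_0
      & p^`()^`() = 'X^(m + k) * r2
        /\ r2`_0 = (m + k).+1%:R * (m + k).+2%:R * r`_0].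
Proof.
move=> p0 pk; have [n [r]] := multiplicity_XsubC p 0.
rewrite p0 subr0 /= mulrC rootE horner_coef0 => r0 def_p.
have kn : (k.+2 <= n)%N.
  rewrite leqNgt; apply/negP => nk; move: r0.
  by have := pk n nk; rewrite def_p coefXnM ltnn subnn => ->; rewrite eqxx.
have {kn def_p} [m def_p] : exists m, p = 'X^((m + k).+2) * r.
  by exists (n - k.+2)%N; rewrite -!addnS subnK.
have dp := deriv_XnSM (m + k).+1 r; rewrite -def_p in dp.
exists m, r; do 2!eexists; split; first exact: r0.
- exact: def_p.
- split; first exact: dp.
  by rewrite -!polyC_natr !coef0E mul0r addr0.
- split; first by rewrite dp deriv_XnSM.
  by rewrite -!polyC_natr !coef0E !mul0r !addr0 mulrA.
Qed.

(** If p vanishes to order N >= 2, then p''^2 has order 2N - 4 while every other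
    term has order at least 2N - 1, so nothing cancels the lowest term of
    9 p''^2. *)
Lemma order_lt2 p : p != 0 -> selfsimilar p -> p`_0 = 0 -> p`_1 != 0.
Proof.
move=> nz_p eq_p p0; apply/eqP => p1.
have [|m [r [r1 [r2 [r0 def_p [dp _] [ddp r2E]]]]]] := @lowest_term p 0 nz_p.
  by case=> [|[]].
move: eq_p; rewrite /selfsimilar ddp dp def_p; set y := 'X^(m + 0).
rewrite !(exprS _ (m + 0).+1) !(exprS _ (m + 0)) -/y => eq_p.
have : y ^+ 2 * (9%:P * r2 ^+ 2 + 'X * ('X ^+2 * (r1 ^+ 2 - r * r2 - r * r1))) = 0.
  by rewrite -[RHS]eq_p polyC_natr; ring.
move/eqP; rewrite mulf_eq0 expf_eq0 /= -size_poly_eq0 size_polyXn /=.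
move/eqP/(congr1 (fun q : {poly C} => q`_0)).
rewrite expr2 !(coef0E, mul0r, addr0, coef0) r2E.
by apply/eqP; rewrite !mulf_neq0 ?pnatr_eq0.
Qed.

(** The shape of the equation for p = P + R, with P the first two terms of p and
    y * 'X * A collecting all that involves the remainder R, which has larger
    order.  The conclusions are the condition on P and the indicial equation of
    R. *)
Lemma split_orders k (e : C) y A :
  y != 0 -> 'X^k * (e%:P + y * 'X * A) = 0 -> e = 0 /\ A`_0 = 0.
Proof.
move=> nzy /eqP; rewrite mulf_eq0 -size_poly_eq0 size_polyXn /= => /eqP eqA.
have e0 : e = 0.
  have /(congr1 (fun q : {poly C} => q`_0)) := eqA.
  by rewrite !(coef0E, mulr0, mul0r, addr0).
split=> //; move/eqP: eqA; rewrite e0 add0r -mulrA mulf_eq0 (negbTE nzy) /=.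
by rewrite mulf_eq0 polyX_eq0 /= => /eqP ->; rewrite coef0.
Qed.

(** Write p = c + d x^3 + R.  The coefficient of x^2 gives d = 0 or 36 d = c.  If
    R has lowest term r0 x^k with k >= 4, the lowest terms linear in R add up to
    r0 (108 d k (k - 1) - c k^2) x^(k-1), and those quadratic in R have order at
    least 2k - 4 > k - 1.  The bracket is - c k^2 or c k (2k - 3), never 0, so
    R = 0. *)
Lemma size_selfsimilar0 p :
  selfsimilar p -> p`_0 != 0 -> p`_1 = 0 -> p`_2 = 0 -> (size p <= 4)%N.
Proof.
move=> eq_p; set c := p`_0; set d := p`_3 => nz_c p1 p2.
set R := p - (c%:P + d%:P * 'X^3).
have defp : p = c%:P + d%:P * 'X^3 + R by rewrite /R; ring.
have coefR i : (i < 4)%N -> R`_i = 0.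
  case: i => [|[|[|[|//]]]] _; rewrite /R !coefE /= -/c -/d ?p1 ?p2; ring.
have [R0 | nzR] := eqVneq R 0.
  apply/leq_sizeP => j j4; rewrite defp R0 !coefE.
  by case: j j4 => [|[|[|[|]]]] //= *; rewrite !(mulr0, addr0).
have [m [r [r1 [r2 [r0 defR [dR r1E] [ddR r2E]]]]]] := lowest_term nzR coefR.
have dp : p^`() = (3 * d)%:P * 'X^2 + R^`().
  rewrite defp !derivD derivC derivM derivC derivXn -mulr_natl.
  by rewrite polyCM polyC_natr; ring.
have ddp : p^`()^`() = (6 * d)%:P * 'X + R^`()^`().
  rewrite dp !derivD derivM derivC derivXn -mulr_natl.
  by rewrite !polyCM !polyC_natr /=; ring.
move: eq_p; rewrite /selfsimilar ddp dp {1 2}defp ddR dR {dp ddp dR ddR}defR.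
rewrite !addn2 (exprS _ m.+3) (exprS _ m.+2) (exprS _ m.+1) (exprS _ m).
rewrite addn2 in r1E r2E; have nzy : 'X^m != 0 :> {poly C}.
  by rewrite -size_poly_eq0 size_polyXn.
move: 'X^m nzy => y nzy eq_p.
(* The value at 0 comes from the first three terms, which are the lowest ones
   linear in R; everything else in the equation carries a further factor x. *)
pose A := - c%:P * r2 - c%:P * r1 + (108 * d)%:P * r2 +
  'X * ('X ^+ 2 * (d%:P * (5 * r1 - r2 - 9 * r))
        + y * (9 * r2 ^+ 2 + 'X ^+ 3 * (r1 ^+ 2 - r * r2 - r * r1))).
have AE : 'X^2 * ((324 * d ^+ 2 - 9 * c * d)%:P + y * 'X * A) = 0.
  rewrite -[RHS]eq_p /A !(polyCM, polyC_natr, polyCB, polyC_exp); ring.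
have [e0 A0] := split_orders nzy AE; exfalso; move: A0; apply/eqP.
rewrite /A !(coef0E, mul0r, addr0, eqxx) r1E r2E.
have /eqP : d * (36 * d - c) = 0.
  by apply: (@mulfI _ 9); rewrite ?pnatr_eq0 // mulr0 -[RHS]e0; ring.
set a := (X in X != 0).
rewrite mulf_eq0 => /orP[/eqP d0 | ].
  have -> : a = - (c * m.+4%:R ^+ 2 * r`_0) by rewrite /a d0; ring.
  by rewrite oppr_eq0 !mulf_neq0 ?expf_neq0 ?pnatr_eq0.
rewrite subr_eq0 => /eqP dE.
have -> : a = c * m.+4%:R * (m.*2 + 5)%:R * r`_0.
  by rewrite /a -dE -mul2n; ring.
by rewrite !mulf_neq0 ?pnatr_eq0 // addnS.
Qed.

(** The analogue for p = c x + d x^4 + R, where the coefficient of x^4 gives d = 0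
    or 144 d = c.  For a lowest term r0 x^k of R with k >= 5, the coefficient of
    x^k is r0 (216 d k (k - 1) - c (k - 1)^2), in which the bracket is
    - c (k - 1)^2 or c (k - 1) (k + 2) / 2. *)
Lemma size_selfsimilar1 p :
  selfsimilar p -> p`_1 != 0 -> p`_0 = 0 -> p`_2 = 0 -> p`_3 = 0 ->
  (size p <= 5)%N.
Proof.
move=> eq_p; set c := p`_1; set d := p`_4 => nz_c p0 p2 p3.
set R := p - (c%:P * 'X + d%:P * 'X^4).
have defp : p = c%:P * 'X + d%:P * 'X^4 + R by rewrite /R; ring.
have coefR i : (i < 5)%N -> R`_i = 0.
  by case: i => [|[|[|[|[|//]]]]] _; rewrite /R !coefE /= -/c -/d ?p0 ?p2 ?p3;
     ring.
have [R0 | nzR] := eqVneq R 0.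
  apply/leq_sizeP => j j4; rewrite defp R0 !coefE.
  by case: j j4 => [|[|[|[|[|]]]]] //= *; rewrite !(mulr0, addr0).
have [m [r [r1 [r2 [r0 defR [dR r1E] [ddR r2E]]]]]] := lowest_term nzR coefR.
have dp : p^`() = c%:P + (4 * d)%:P * 'X^3 + R^`().
  rewrite defp !derivD (derivM _ 'X) (derivM _ 'X^4) !derivC derivX derivXn.
  rewrite -mulr_natl.
  by rewrite polyCM polyC_natr /=; ring.
have ddp : p^`()^`() = (12 * d)%:P * 'X^2 + R^`()^`().
  rewrite dp !derivD (derivM _ 'X^3) !derivC derivXn -mulr_natl.
  by rewrite !polyCM !polyC_natr /=; ring.
move: eq_p; rewrite /selfsimilar ddp dp {1 2}defp ddR dR {dp ddp dR ddR}defR.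
rewrite !addn3 (exprS _ m.+4) (exprS _ m.+3) (exprS _ m.+2) (exprS _ m.+1).
rewrite (exprS _ m).
rewrite addn3 in r1E r2E; have nzy : 'X^m != 0 :> {poly C}.
  by rewrite -size_poly_eq0 size_polyXn.
move: 'X^m nzy => y nzy eq_p.
pose A := c%:P * (r1 - r2 - r) + (216 * d)%:P * r2 +
  'X * ('X ^+ 2 * (d%:P * (7 * r1 - r2 - 16 * r))
        + y * (9 * r2 ^+ 2 + 'X ^+ 3 * (r1 ^+ 2 - r * r2 - r * r1))).
have AE : 'X^4 * ((1296 * d ^+ 2 - 9 * c * d)%:P + y * 'X * A) = 0.
  rewrite -[RHS]eq_p /A !(polyCM, polyC_natr, polyCB, polyC_exp); ring.
have [e0 A0] := split_orders nzy AE; exfalso; move: A0; apply/eqP.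
rewrite /A !(coef0E, mul0r, addr0, eqxx) r1E r2E.
have /eqP : d * (144 * d - c) = 0.
  by apply: (@mulfI _ 9); rewrite ?pnatr_eq0 // mulr0 -[RHS]e0; ring.
set a := (X in X != 0).
rewrite mulf_eq0 => /orP[/eqP d0 | ].
  have -> : a = - (c * m.+4%:R ^+ 2 * r`_0) by rewrite /a d0; ring.
  by rewrite oppr_eq0 !mulf_neq0 ?expf_neq0 ?pnatr_eq0.
rewrite subr_eq0 => /eqP dE.
suff: 2 * a != 0 by apply: contraNneq => ->; rewrite mulr0.
have -> : 2 * a = c * m.+4%:R * m.+1.+4.+2%:R * r`_0 by rewrite /a -dE; ring.
by rewrite !mulf_neq0 ?pnatr_eq0.
Qed.

End SelfSimilar.

(** * The weight bound *)

Section Weight.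
Variable C : numFieldType.
Implicit Types f F G : bipoly C.

Lemma coef_dx F i : (dx F)`_i = F`_i.+1 *+ i.+1.
Proof. exact: coef_deriv. Qed.

Lemma coef_dt F i : (dt F)`_i = (F`_i)^`().
Proof. by rewrite /dt coef_map_id0 ?deriv0. Qed.

Lemma coef_Xdx F i : (Xx * dx F)`_i = F`_i *+ i.
Proof. by rewrite coefXM coef_dx; case: i => //=; rewrite mulr0n. Qed.

Lemma dt_Xx F : dt (Xx * F) = Xx * dt F.
Proof.
by apply/polyP => i; rewrite coef_dt !coefXM coef_dt; case: ifP; rewrite ?deriv0.
Qed.

Lemma bilinear_eqE f : bilinear_eq f <-> hirota (@dx C) (@dt C) f = 0.
Proof.
rewrite /bilinear_eq (_ : _ + _ = 2 * hirota (@dx C) (@dt C) f); last first.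
  by rewrite /hirota; ring.
split=> [/eqP|->]; last exact: mulr0.
by rewrite mulf_eq0 -!polyC_natr !polyC_eq0 pnatr_eq0 => /eqP.
Qed.

Definition weight_le n F := forall i j, (n < i + 3 * j)%N -> F`_i`_j = 0.

(** Downward induction on i.  In the coefficient of x^(n+i) t^(j-1) in x times the
    equation, a product of two coefficients of f has total weight
    n + i + 3 j > 2 n, so one of its factors has weight greater than n and
    vanishes by induction, unless the factors come from x^i and x^n.  As f_n = 1
    is constant, this leaves (i - n) j f_ij = 0. *)
Lemma weight_le_sol f n :
  f \is monic -> size f = n.+1 -> bilinear_eq f -> weight_le n f.
Proof.
move=> mon_f sz_f /bilinear_eqE eq_f.
have f_top i : (n < i)%N -> f`_i = 0 by move=> ni; rewrite nth_default ?sz_f.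
have f_n : f`_n = 1 by move/monicP: mon_f; rewrite lead_coefE sz_f.
suff bound k : forall i j, (n <= i + k)%N -> (n < i + 3 * j)%N -> f`_i`_j = 0.
  by move=> i j; apply: (bound n); apply: leq_addl.
elim: k => [|k IHk] i j.
  rewrite addn0 leq_eqVlt => /orP[/eqP <- nj | /f_top ->]; last by rewrite coef0.
  by rewrite f_n coef1; case: j nj => //; rewrite muln0 addn0 ltnn.
move=> nik; have [/IHk|ikn] := leqP n (i + k); first exact.
have {nik IHk} IH b c : (i < b)%N -> (n < b + 3 * c)%N -> f`_b`_c = 0.
  by move=> ib; apply: IHk; lia.
case: j => [|j] nij; first by lia.
(* Multiplying by x turns d/dx into the Euler operator, so that the pair of
   exponents b and n + i - b occurs with the factor b - (n + i - b). *)
pose D b := ((f`_b)^`() * f`_(n + i - b))`_j.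
have D0 b : b <> i -> D b = 0.
  move=> bi; rewrite /D coefM big1 // => -[c /= cj] _; rewrite coef_deriv.
  have [bn|nb|->] := ltngtP b n; last 2 first.
  - by rewrite f_top // coef0 mul0rn mul0r.
  - by rewrite f_n coef1 mul0rn mul0r.
  have [ib|bi'] := ltnP i b; last first.
    by rewrite [f`_(_ - _)]f_top ?coef0 ?mulr0 //; lia.
  have [w|w] := ltnP n (b + 3 * c.+1); first by rewrite IH // mul0rn mul0r.
  by rewrite [f`_(_ - _)`__]IH ?mulr0 //; lia.
have eqD : \sum_(b < (n + i).+1) (D b *+ b - D b *+ (n + i - b)) = 0.
  have /(congr1 (fun F : bipoly C => (Xx * F)`_(n + i)`_j)) := eq_f.
  rewrite mulr0 !coef0 => e; rewrite -[RHS]e {e}.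
  have -> : Xx * (dt (dx f) * f - dt f * dx f + 3 * dx (dx f) ^+ 2)
    = dt (Xx * dx f) * f - dt f * (Xx * dx f) + Xx * dx (dx f) ^+ 2 *+ 3.
    by rewrite dt_Xx; ring.
  rewrite !(coefMn, coefD, coefN) [X in _ + X](_ : _ = 0) ?addr0; last first.
    rewrite coefXM; case: eqP => [|/eqP ni]; rewrite ?coef0 ?mul0rn //.
    rewrite expr2 coefM.
    rewrite coef_sum big1 ?mul0rn // => -[b /= bni] _.
    rewrite coefM big1 // => -[c /= cj] _; rewrite !coef_dx !coefMn.
    set l := ((n + i).-1 - b)%N.
    have [bn|bn] := ltnP n b.+2.
      by rewrite [f`_b.+2]f_top ?coef0 ?mul0rn ?mul0r.
    have [ln|ln] := ltnP n l.+2.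
      by rewrite [f`_l.+2]f_top ?coef0 ?mul0rn ?mulr0.
    have [w|w] := ltnP n (b.+2 + 3 * c).
      by rewrite [f`_b.+2`__]IH ?mul0rn ?mul0r //; lia.
    by rewrite [f`_l.+2`__]IH ?mul0rn ?mulr0 //; lia.
  rewrite !coefM !coef_sum -sumrB; apply: eq_bigr => -[b /= bni] _.
  rewrite coef_dt !coef_Xdx derivMn coef_dt mulrnAl mulrnAr.
  by rewrite !coefMn.
have Di : D i = f`_i`_j.+1 *+ j.+1.
  by rewrite /D addnK f_n mulr1 coef_deriv.
move: eqD; have ii : (i < (n + i).+1)%N by rewrite ltnS leq_addl.
rewrite (bigD1 (Ordinal ii)) //= big1 ?addr0; last first.
  move=> b /eqP bi; rewrite D0 ?mul0rn ?subr0 // => bi'.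
  by apply: bi; apply/val_inj.
rewrite addnK Di -!mulrnA -[_ *+ (_ * i)]mulr_natr -[_ *+ (_ * n)]mulr_natr -mulrBr.
move/eqP; rewrite mulf_eq0 => /orP[/eqP //|].
rewrite subr_eq0 eqr_nat eqn_pmul2l // => /eqP; lia.
Qed.

(** * The part of top weight *)

(** F(x s, s^3), as a polynomial in s over C[x]: its coefficient of s^w is the part
    of F of weight w, evaluated at t = 1. *)
Definition by_weight F : {poly {poly C}} :=
  swapXY (map_poly (comp_poly 'X^3) F \Po ('X%:P * 'X)).

Lemma coef_by_weight F w i :
  (by_weight F)`_w`_i =
  if (i <= w)%N && (3 %| w - i)%N then F`_i`_((w - i) %/ 3) else 0.
Proof.
rewrite coef_swapXY coef_comp_scaleX coef_map coefMXn coef_comp_poly_Xn //.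
by rewrite ltnNge; case: (i <= w)%N.
Qed.

Lemma by_weightM F G : by_weight (F * G) = by_weight F * by_weight G.
Proof. by rewrite /by_weight rmorphM comp_polyM rmorphM. Qed.

Lemma by_weightD F G : by_weight (F + G) = by_weight F + by_weight G.
Proof. by rewrite /by_weight rmorphD comp_polyD rmorphD. Qed.

Lemma by_weightB F G : by_weight (F - G) = by_weight F - by_weight G.
Proof. by rewrite /by_weight rmorphB comp_polyB rmorphB. Qed.

Lemma by_weightMn F k : by_weight (F *+ k) = by_weight F *+ k.
Proof. by rewrite /by_weight !rmorphMn. Qed.

Lemma by_weight0 : by_weight 0 = 0.
Proof. by rewrite /by_weight !rmorph0. Qed.

Lemma size_by_weight n F : weight_le n F -> (size (by_weight F) <= n.+1)%N.
Proof.
move=> wF; apply/leq_sizeP => w nw; apply/polyP => i.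
rewrite coef_by_weight coef0; case: andP => // -[iw /divnK]; rewrite mulnC => w3.
by apply: wF; rewrite w3 subnKC.
Qed.

Lemma by_weight_top F G m n : weight_le m F -> weight_le n G ->
  (by_weight (F * G))`_(m + n) = (by_weight F)`_m * (by_weight G)`_n.
Proof. by move=> /size_by_weight Fm /size_by_weight Gn; rewrite by_weightM coefM_top. Qed.

Lemma coef_Xtdt F i j : (Xt * dt F)`_i`_j = F`_i`_j *+ j.
Proof.
rewrite coefCM coef_dt coefXM coef_deriv.
by case: j => //=; rewrite mulr0n.
Qed.

Lemma by_weight_Xdx F w : (by_weight (Xx * dx F))`_w = 'X * ((by_weight F)`_w)^`().
Proof.
apply/polyP => i; rewrite coef_by_weight coef_Xdx coefMn coefXM.
case: i => [|i] /=; first by rewrite mulr0n if_same.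
by rewrite coef_deriv coef_by_weight; case: ifP; rewrite ?mul0rn.
Qed.

(** Euler's relation for the part of weight w. *)
Lemma by_weight_Xtdt F w :
  (by_weight (Xt * dt F))`_w *+ 3 =
  (by_weight F)`_w *+ w - 'X * ((by_weight F)`_w)^`().
Proof.
apply/polyP => i; rewrite -by_weight_Xdx coefB !coefMn !coef_by_weight.
rewrite coef_Xtdt coef_Xdx coefMn.
case: andP => [[iw /divnK w3]|_]; last by rewrite !mul0rn subr0.
by rewrite -mulrnA w3 mulrnBr.
Qed.

Lemma by_weight_Xx : (by_weight Xx)`_1 = 'X.
Proof.
apply/polyP => i; rewrite coef_by_weight !coefX.
by case: i => [|[|]] //=; rewrite coef1.
Qed.

Lemma by_weight_Xt : (by_weight Xt)`_3 = 1.
Proof.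
apply/polyP => i; rewrite coef_by_weight coefC coef1.
by case: i => [|[|i]] /=; rewrite ?coefX ?coef0 ?if_same.
Qed.

Lemma weight_le_Xx : weight_le 1 (Xx : bipoly C).
Proof.
move=> i j; rewrite coefX; case: eqP => [->|]; last by rewrite coef0.
by rewrite coef1; case: j.
Qed.

Lemma weight_le_Xt : weight_le 3 (Xt : bipoly C).
Proof.
move=> i j; rewrite coefC; case: eqP => [->|]; last by rewrite coef0.
by rewrite coefX; case: eqP => // ->.
Qed.

Lemma weight_le_Xdx F n : weight_le n F -> weight_le n (Xx * dx F).
Proof. by move=> wF i j nij; rewrite coef_Xdx coefMn wF ?mul0rn. Qed.

Lemma weight_le_Xtdt F n : weight_le n F -> weight_le n (Xt * dt F).
Proof. by move=> wF i j nij; rewrite coef_Xtdt wF ?mul0rn. Qed.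

Lemma weight_leB F G n : weight_le n F -> weight_le n G -> weight_le n (F - G).
Proof. by move=> wF wG i j nij; rewrite !coefB wF ?wG ?subr0. Qed.

Lemma weight_leM F G m n :
  weight_le m F -> weight_le n G -> weight_le (m + n) (F * G).
Proof.
move=> wF wG i j nij; rewrite coefM coef_sum big1 // => -[a /= ai] _.
rewrite coefM big1 // => -[b /= bj] _.
have [w|w] := ltnP m (a + 3 * b); first by rewrite wF ?mul0r.
by rewrite wG ?mulr0 //; lia.
Qed.

(** The equation is multiplied by x^4 t so that it becomes an identity between the
    weight-preserving operators x d/dx and t d/dt; its part of weight 2 n + 3
    then involves only the top parts of f and of its images. *)
Lemma selfsimilar_top f n :
  bilinear_eq f -> weight_le n f -> selfsimilar (by_weight f)`_n.
Proof.
move=> /bilinear_eqE eq_f wf; set p := (by_weight f)`_n.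
set g := Xx * dx f; have wg : weight_le n g by apply: weight_le_Xdx.
set h := Xx * dx g - g.
have wh : weight_le n h by apply: weight_leB => //; apply: weight_le_Xdx.
have wX3 : weight_le 3 (Xx * (Xx * Xx) : bipoly C).
  by do 2!apply: (@weight_leM _ _ 1 _ weight_le_Xx _) => //; apply: weight_le_Xx.
have eqT : Xx * (Xx * Xx) * ((Xt * dt g) * f - (Xt * dt f) * g)
           + Xt * (h * h) *+ 3 = 0.
  rewrite -[RHS](mulr0 (Xx ^+ 4 * Xt)) -eq_f /hirota /h /g dt_Xx.
  rewrite (_ : dx (Xx * dx f) = dx f + Xx * dx (dx f)); first by ring.
  by rewrite /dx derivM derivX mul1r.
have wgf := weight_leM (weight_le_Xtdt wg) wf.
have wfg := weight_leM (weight_le_Xtdt wf) wg.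
have := congr1 (fun F => (by_weight F)`_(3 + (n + n)) *+ 3) eqT.
rewrite by_weight0 by_weightD by_weightMn coef0 mul0rn coefD coefMn.
have wX := weight_le_Xx.
rewrite (by_weight_top wX3 (weight_leB wgf wfg)).
rewrite (by_weight_top weight_le_Xt (weight_leM wh wh)) (by_weight_top wh wh).
rewrite (by_weight_top wX (weight_leM wX wX)) (by_weight_top wX wX).
rewrite by_weight_Xx by_weight_Xt !by_weightB !coefB by_weight_Xdx.
rewrite (by_weight_top (weight_le_Xtdt wg) wf).
rewrite (by_weight_top (weight_le_Xtdt wf) wg).
set tg := (by_weight (Xt * dt g))`_n; set tf := (by_weight (Xt * dt f))`_n.
have gE : (by_weight g)`_n = 'X * p^`() by exact: by_weight_Xdx.
have tgE : tg *+ 3 = 'X * p^`() *+ n - 'X * (p^`() + 'X * p^`()^`()).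
  by rewrite /tg by_weight_Xtdt gE derivM derivX mul1r.
have tfE : tf *+ 3 = p *+ n - 'X * p^`() by exact: by_weight_Xtdt.
rewrite gE derivM derivX mul1r -/p => eq0.
have : 'X^4 * ('X * (p^`() ^+ 2 - p * p^`()^`()) - p * p^`()
               + 9 * p^`()^`() ^+ 2) = 0.
  rewrite -[RHS]eq0.
  transitivity ('X * ('X * 'X) * ((tg *+ 3) * p - (tf *+ 3) * ('X * p^`()))
     + 9 * ('X ^+ 2 * p^`()^`()) ^+ 2); last by ring.
  by rewrite tgE tfE; ring.
by move/eqP; rewrite mulf_eq0 -size_poly_eq0 size_polyXn /= => /eqP.
Qed.

(** The top part p has degree n, so the bounds on its size bound n; the gaps of
    length 3 between its exponents provide the vanishing low coefficients. *)
Lemma degree_cases f n :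
  f \is monic -> size f = n.+1 -> bilinear_eq f -> n \in [:: 0; 1; 3; 4]%N.
Proof.
move=> mon_f sz_f eq_f.
set p := (by_weight f)`_n.
have eq_p : selfsimilar p.
  by apply: selfsimilar_top => //; apply: weight_le_sol.
have pn : p`_n = 1.
  rewrite coef_by_weight leqnn subnn dvdn0 div0n /=.
  by move/monicP: mon_f; rewrite lead_coefE sz_f => ->; rewrite coef1.
have sz_p k : (size p <= k)%N -> (n < k)%N.
  apply: leq_trans; rewrite ltnNge; apply/negP => /leq_sizeP/(_ n (leqnn n))/eqP.
  by rewrite pn oner_eq0.
have p_sparse i : p`_i != 0 -> (i <= n)%N && (3 %| n - i)%N.
  by rewrite coef_by_weight; case: ifP => //; rewrite eqxx.
have p_0 i : ~~ ((i <= n)%N && (3 %| n - i)%N) -> p`_i = 0.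
  by move=> ni; apply/eqP; apply: contraNT ni => /p_sparse.
have [p0 | p0] := eqVneq p`_0 0; last first.
  have := p_sparse 0%N p0 => n3; have : (n < 4)%N.
    by apply/sz_p/size_selfsimilar0 => //; apply: p_0; lia.
  by case: n n3 {sz_f pn sz_p p_0 p_sparse p p0 eq_p} => [|[|[|[|]]]].
have nz_p : p != 0.
  by apply: contra_eq_neq pn => ->; rewrite coef0 eq_sym oner_eq0.
have p1 := order_lt2 nz_p eq_p p0.
have := p_sparse 1%N p1 => n3; have : (n < 5)%N.
  by apply/sz_p/size_selfsimilar1 => //; apply: p_0; lia.
by case: n n3 {sz_f pn sz_p p_0 p_sparse p p0 eq_p nz_p p1} => [|[|[|[|[|]]]]].
Qed.

(** * Solutions of degree at most 4 *)

HB.instance Definition _ := GRing.RMorphism.copy (@cst C) (polyC \o polyC).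

Lemma xt_cst : xt_derivations (@cst C) Xx Xt (@dx C) (@dt C).
Proof.
split; first split; try split; try split.
- exact: derivD.
- exact: derivM.
- exact: raddfD.
- move=> F G; apply/polyP => i.
  rewrite coefD coef_dt !coefM raddf_sum -big_split /=.
  by apply: eq_bigr => j _; rewrite derivM !coef_dt.
- exact: derivX.
- exact: derivC.
- apply/polyP=> i.
  by rewrite coef_dt coefX coef0 -[X in X^`()]polyC_natr derivC.
- by rewrite /dt map_polyC /= derivX.
- exact: derivC.
- by rewrite /dt map_polyC /= derivC.
Qed.

Lemma cst_sum_eq0 (e : seq C) :
  \sum_(k < size e) cst e`_k * Xx ^+ k = 0 <-> forall i, e`_i = 0.
Proof.
split=> [sum0 i | e0]; last first.
  by apply: big1 => k _; rewrite e0 /cst !polyC0 mul0r.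
have [ie|ei] := ltnP i (size e); last exact: nth_default.
move/(congr1 (fun F : bipoly C => F`_i`_0)): sum0.
rewrite !coef0 => sum0; rewrite -[RHS]sum0.
rewrite !coef_sum (bigD1 (Ordinal ie)) //= big1 => [|k].
  by rewrite coefCM coefXn eqxx mulr1 coefC addr0.
rewrite -val_eqE eq_sym /= => /negbTE ki.
by rewrite coefCM coefXn ki mulr0 coef0.
Qed.

Lemma cubic_sol (c0 c1 c2 u : C) :
  bilinear_eq (Xx ^+ 3 + cst c2 * Xx ^+ 2 + cst c1 * Xx + cst u * Xt + cst c0)
  <-> u = 36 /\ c1 = 1 / 3 * c2 ^+ 2.
Proof.
rewrite bilinear_eqE (hirota_cubic _ _ _ _ xt_cst).
rewrite cst_sum_eq0; split=> [e0 | [uE cE] i]; last first.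
  rewrite uE cE; case: i => [|[|[|i]]] /=; last by rewrite nth_nil.
  - by field; rewrite ?pnatr_eq0.
  - by ring.
  - by ring.
have uE : u = 36.
  apply: (@mulfI _ 3); rewrite ?pnatr_eq0 //.
  transitivity (108 - (108 - 3 * u)); first by ring.
  by rewrite [X in _ - X](e0 2%N); ring.
split=> //; apply: (@mulfI _ 36); rewrite ?pnatr_eq0 //.
transitivity (12 * c2 ^+2 - (12 * c2 ^+ 2 - u * c1)); first by rewrite uE; ring.
by rewrite [X in _ - X](e0 0%N); field; rewrite ?pnatr_eq0.
Qed.

Lemma quartic_sol (c0 c1 c2 c3 u v : C) :
  bilinear_eq (Xx ^+ 4 + cst c3 * Xx ^+ 3 + cst c2 * Xx ^+ 2
               + (cst u * Xt + cst c1) * Xx + cst v * Xt + cst c0)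
  <-> [/\ u = 144, v = 36 * c3 & c0 = 1 / 4 * c1 * c3 - 1 / 12 * c2 ^+ 2].
Proof.
rewrite bilinear_eqE (hirota_quartic _ _ _ _ _ _ xt_cst).
rewrite cst_sum_eq0; split=> [e0 | [uE vE cE] i]; last first.
  rewrite uE vE cE; case: i => [|[|[|[|[|i]]]]] /=; last by rewrite nth_nil.
  - by field; rewrite ?pnatr_eq0.
  - by ring.
  - by ring.
  - by ring.
  - by ring.
have uE : u = 144.
  apply: (@mulfI _ 3); rewrite ?pnatr_eq0 //.
  transitivity (432 - (432 - 3 * u)); first by ring.
  by rewrite [X in _ - X](e0 4%N); ring.
have vE : v = 36 * c3.
  apply: (@mulfI _ 4); rewrite ?pnatr_eq0 //.
  transitivity (432 * c3 - 2 * u * c3 - (432 * c3 - 2 * u * c3 - 4 * v)).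
    by ring.
  by rewrite [X in _ - X](e0 3%N) uE; ring.
split=> //; apply: (@mulfI _ 144); rewrite ?pnatr_eq0 //.
transitivity (v * c1 - 12 * c2 ^+ 2 + (u * c0 - v * c1 + 12 * c2 ^+ 2)).
  by rewrite uE; ring.
by rewrite [X in _ + X](e0 0%N) vE; field; rewrite ?pnatr_eq0.
Qed.

(** Weight at most n bounds the t-degree of the coefficient of x^i by
    (n - i) / 3. *)
Lemma weight_const f n i :
  weight_le n f -> (n < i + 3)%N -> exists c, f`_i = c%:P.
Proof.
move=> wf ni; exists f`_i`_0; apply/polyP => -[|j]; rewrite coefC //= wf //; lia.
Qed.

Lemma weight_affine f n i :
  weight_le n f -> (n < i + 6)%N -> exists u c, f`_i = u%:P * 'X + c%:P.
Proof.
move=> wf ni; exists f`_i`_1, f`_i`_0; apply/polyP => -[|[|j]];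
  rewrite coefD coefMX !coefC /= ?add0r ?addr0 // wf //; lia.
Qed.

Theorem fundamental_solutionE f :
  fundamental_solution f <->
  [\/ f = 1,
      exists c0 : C, f = Xx + cst c0,
      exists c0 c2 : C,
        f = Xx ^+ 3 + cst c2 * Xx ^+ 2 + cst (1 / 3 * c2 ^+ 2) * Xx
            + 36 * Xt + cst c0
    | exists c1 c2 c3 : C,
        f = Xx ^+ 4 + cst c3 * Xx ^+ 3 + cst c2 * Xx ^+ 2
            + (144 * Xt + cst c1) * Xx + 36 * cst c3 * Xt
            + cst (1 / 4 * c1 * c3 - 1 / 12 * c2 ^+ 2)].
Proof.
split=> [[mon_f eq_f] | ].
  have [n sz_f] : exists n, size f = n.+1.
    exists (size f).-1; rewrite prednK // size_poly_gt0; exact: monic_neq0.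
  have := degree_cases mon_f sz_f eq_f.
  have wf := weight_le_sol mon_f sz_f eq_f.
  have f_n : f`_n = 1 by move/monicP: mon_f; rewrite lead_coefE sz_f.
  have fE : f = \sum_(i < n.+1) (f`_i)%:P * Xx ^+ i.
    rewrite -[LHS]coefK poly_def sz_f.
    by apply: eq_bigr => i _; rewrite -mul_polyC.
  rewrite !inE => /or4P[] /eqP nE; rewrite nE !big_ord_recr big_ord0 /= in fE;
    rewrite nE in wf f_n; rewrite f_n in fE.
  - by constructor 1; rewrite fE add0r mul1r expr0.
  - have [c0 f0] := weight_const wf (isT : (1 < 0 + 3)%N).
    constructor 2; exists c0; rewrite fE f0 expr0 expr1 mul1r mulr1 add0r.
    exact: addrC.
  - have [c2 f2] := weight_const wf (isT : (3 < 2 + 3)%N).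
    have [c1 f1] := weight_const wf (isT : (3 < 1 + 3)%N).
    have [u [c0 f0]] := weight_affine wf (isT : (3 < 0 + 6)%N).
    have {}fE :
        f = Xx ^+ 3 + cst c2 * Xx ^+ 2 + cst c1 * Xx + cst u * Xt + cst c0.
      rewrite fE f0 f1 f2 polyCD polyCM expr0 expr1 mul1r mulr1 add0r.
      by rewrite -!/(cst _) -!/Xt; ring.
    move: eq_f; rewrite fE cubic_sol => -[-> ->].
    by constructor 3; exists c0, c2; rewrite (rmorph_nat (@cst C)).
  - have [c3 f3] := weight_const wf (isT : (4 < 3 + 3)%N).
    have [c2 f2] := weight_const wf (isT : (4 < 2 + 3)%N).
    have [u [c1 f1]] := weight_affine wf (isT : (4 < 1 + 6)%N).
    have [v [c0 f0]] := weight_affine wf (isT : (4 < 0 + 6)%N).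
    have {}fE : f = Xx ^+ 4 + cst c3 * Xx ^+ 3 + cst c2 * Xx ^+ 2
                 + (cst u * Xt + cst c1) * Xx + cst v * Xt + cst c0.
      rewrite fE f0 f1 f2 f3 !polyCD !polyCM expr0 expr1 mul1r mulr1 add0r.
      by rewrite -!/(cst _) -!/Xt; ring.
    move: eq_f; rewrite fE quartic_sol => -[-> -> ->].
    by constructor 4; exists c1, c2, c3; rewrite rmorphM !(rmorph_nat (@cst C)).
have [[derD derT] [DX Dt] [TX Tt] Dk] := xt_cst.
have {Dk} [Dk Tk] :
    (forall c : C, dx (cst c) = 0) /\ (forall c : C, dt (cst c) = 0).
  by split=> c; case: (Dk c).
have DE := (derivationE derD, DX, Dk); have TE := (derivationE derT, TX, Tk).
case=> [->|[c0 ->]|[c0 [c2 ->]]|[c1 [c2 [c3 ->]]]]; split.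
- exact: monic1.
- by rewrite bilinear_eqE /hirota !DE !TE expr0n !(mul0r, mulr0) subr0 addr0.
- exact: monicXnD (size_polyC_leq1 _).
- rewrite bilinear_eqE /hirota !DE !TE.
  by rewrite !addr0 mul0r mul0r subr0 expr2 !mulr0 addr0.
- rewrite -!addrA; apply: monicXnD; apply/leq_sizeP => j j3.
  rewrite -(rmorph_nat (@cst C)) !(coefD, coefCM, coefXn, coefX, coefC).
  by case: j j3 => [|[|[|j]]] //= _; rewrite !(mulr0, addr0).
- by rewrite -(rmorph_nat (@cst C)); apply/cubic_sol.
- rewrite -!addrA; apply: monicXnD; apply/leq_sizeP => j j3.
  rewrite -!(rmorph_nat (@cst C)) -rmorphM.
  rewrite mulrDl -(mulrA (cst _)) !(coefD, coefCM, coefXn, coefX, coefC).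
  by case: j j3 => [|[|[|[|j]]]] //= _; rewrite !(mulr0, addr0).
- by rewrite -!(rmorph_nat (@cst C)) -rmorphM; apply/quartic_sol.
Qed.

End Weight.

Theorem theorem4 (R : realType) (f : bipoly (complex R)) :
  fundamental_solution f <->
  [\/ f = 1,
      exists c0 : complex R, f = Xx + cst c0,
      exists c0 c2 : complex R,
        f = Xx ^+ 3 + cst c2 * Xx ^+ 2 + cst (1 / 3 * c2 ^+ 2) * Xx
            + 36 * Xt + cst c0
    | exists c1 c2 c3 : complex R,
        f = Xx ^+ 4 + cst c3 * Xx ^+ 3 + cst c2 * Xx ^+ 2
            + (144 * Xt + cst c1) * Xx + 36 * cst c3 * Xt
            + cst (1 / 4 * c1 * c3 - 1 / 12 * c2 ^+ 2)].
Proof.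
exact: fundamental_solutionE.
Qed.
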